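(* The ternary quintic $F = xyz^3 + y^4 z \in \mathbb{C}[x,y,z]$ has Waring rank $r(F)=10$. In particular, there exists a form of degree $5$ in $3$ variables of Waring rank $10$.
   Context: The Waring rank $r(F)$ of a homogeneous form $F$ of degree $d$ is the least $r$ such that $F=\sum_{i=1}^r c_i\ell_i^d$ for some linear forms $\ell_i$ and scalars $c_i\in\mathbb{C}$. *)

(* Defs.v *)
From HB Require Import structures.
From mathcomp Require Import all_boot all_order all_algebra.
Set Implicit Arguments. Unset Strict Implicit. Unset Printing Implicit Defensive.
Import Order.TTheory GRing.Theory Num.Theory.
Local Open Scope ring_scope.

(* Trivariate polynomials C[x,y,z] encoded as iterated univariate
   polynomials ((C[x])[y])[z]. *)
Definition poly3 (C : numClosedFieldType) := {poly {poly {poly C}}}.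

Definition varx (C : numClosedFieldType) : poly3 C := ('X%:P)%:P.
Definition vary (C : numClosedFieldType) : poly3 C := 'X%:P.
Definition varz (C : numClosedFieldType) : poly3 C := 'X.
Definition cst3 (C : numClosedFieldType) (c : C) : poly3 C := c%:P%:P%:P.

Definition linform (C : numClosedFieldType) (a b c : C) : poly3 C :=
  cst3 a * varx C + cst3 b * vary C + cst3 c * varz C.

Definition waring_decomp (C : numClosedFieldType) (F : poly3 C) (d r : nat) : Prop :=
  exists (a b c k : 'I_r -> C),
    F = \sum_(i < r) cst3 (k i) * linform (a i) (b i) (c i) ^+ d.

Definition waring_rank_is (C : numClosedFieldType) (F : poly3 C) (d r : nat) : Prop :=
  waring_decomp F d r /\ (forall r', waring_decomp F d r' -> (r <= r')%N).

Definition F12 (C : numClosedFieldType) : poly3 C :=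
  varx C * vary C * varz C ^+ 3 + vary C ^+ 4 * varz C.

(* Main.v *)
Require Import Defs.
From HB Require Import structures.
From mathcomp Require Import all_boot all_order all_algebra.
From mathcomp Require Import ring zify.
Set Implicit Arguments. Unset Strict Implicit. Unset Printing Implicit Defensive.
Import Order.TTheory GRing.Theory Num.Theory.
Local Open Scope ring_scope.

(** Lower bound: normalise the linear forms with [a <> 0] to [x + u y + v z].
    The weighted moments of the points [(u, v)] in degree at most 4 are those of
    the derivative of [F] in [x], proportional to [y z^3]: only [u v^3] has a
    nonzero moment.  Pairing monomials gives triangular moment matrices, whose
    size bounds the number of such points from below: 8 always, and, by means of
    the moments of degree 5, 9 if a single form has [a = 0] and 10 if none has. *)

(** The matrix of pairings factors through the functions on [S], so its rank is at most [#|S|];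
    being triangular with nonzero diagonal, it has rank [m]. *)
Lemma triangular_pairing_card (F : fieldType) (I : finType) (S : {set I}) m
    (w : I -> F) (p q : 'I_m -> I -> F) :
  (forall i, i \notin S -> w i = 0) ->
  (forall j k : 'I_m, (j < k)%N -> \sum_i w i * (p k i * q j i) = 0) ->
  (forall j, \sum_i w i * (p j i * q j i) != 0) ->
  (m <= #|S|)%N.
Proof.
move=> wS offdiag diag.
pose A : 'M[F]_(m, #|S|) := \matrix_(j, i) (w (enum_val i) * q j (enum_val i)).
pose B : 'M[F]_(#|S|, m) := \matrix_(i, j) p j (enum_val i).
have ABE j k : (A *m B) j k = \sum_i w i * (p k i * q j i).
  rewrite mxE (bigID (mem S)) /= [X in _ = _ + X]big1 ?addr0; last first.
    by move=> i /wS ->; rewrite mul0r.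
  rewrite [RHS]big_enum_val; apply: eq_bigr => i _.
  by rewrite !mxE mulrAC mulrA.
have trig : is_trig_mx (A *m B).
  by apply/is_trig_mxP => j k ltjk; rewrite ABE offdiag.
have : A *m B \in unitmx.
  rewrite unitmxE det_trig // unitfE prodf_seq_neq0.
  by apply/allP => j _ /=; rewrite ABE diag.
rewrite -row_full_unit => /eqP <-.
exact: leq_trans (mxrankM_maxl _ _) (rank_leq_col _).
Qed.

(* An entry [(e, f)] of [E] stands for the monomials [u^e.1 v^e.2] (column) and
   [u^f.1 v^f.2] (row) of a matrix of moments of degree at most 5. *)
Lemma moment_points_card (F : fieldType) (I : finType) (S : {set I})
    (w u v : I -> F) (top : nat * nat) (E : seq ((nat * nat) * (nat * nat))) :
  let mom s t := \sum_i w i * (u i ^+ s * v i ^+ t) in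
  (forall i, i \notin S -> w i = 0) ->
  (forall s t, (s + t <= 4)%N -> (mom s t == 0) = ((s, t) != (1, 3)%N)) ->
  mom top.1 top.2 != 0 ->
  pairwise (fun x y => let s := (y.1.1 + x.2.1)%N in let t := (y.1.2 + x.2.2)%N in
     (s + t <= 4)%N && ((s, t) != (1, 3)%N)) E ->
  all (fun x => (x.1.1 + x.2.1, x.1.2 + x.2.2)%N \in [:: (1, 3)%N; top]) E ->
  (size E <= #|S|)%N.
Proof.
move=> mom wS low high offdiag diag; pose z := ((0, 0), (0, 0))%N.
have prodE i (e f : nat * nat) : u i ^+ e.1 * v i ^+ e.2 * (u i ^+ f.1 * v i ^+ f.2)
    = u i ^+ (e.1 + f.1) * v i ^+ (e.2 + f.2).
  by rewrite mulrACA -!exprD.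
pose p (j : 'I_(size E)) i := u i ^+ (nth z E j).1.1 * v i ^+ (nth z E j).1.2.
pose q (j : 'I_(size E)) i := u i ^+ (nth z E j).2.1 * v i ^+ (nth z E j).2.2.
apply: (@triangular_pairing_card _ _ S _ w p q) => // [j k ltjk|j].
  have /(pairwiseP z) /(_ j k) := offdiag.
  rewrite !inE !ltn_ord => /(_ isT isT ltjk) /= /andP[le4 ne13].
  under eq_bigr => i _ do rewrite prodE.
  by apply/eqP; rewrite low.
under eq_bigr => i _ do rewrite prodE.
have /(all_nthP z) /(_ j (ltn_ord j)) := diag.
rewrite !inE => /orP[/eqP[-> ->]|/eqP eq_top]; first by rewrite -/(mom 1%N 3%N) low.
by move: high; rewrite -eq_top.
Qed.

Lemma coef_linear_exp (R : comNzRingType) (p q : R) n k :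
  ((p%:P + q%:P * 'X) ^+ n)`_k = p ^+ (n - k) * q ^+ k *+ 'C(n, k).
Proof.
rewrite exprDn coef_sum.
have E (i : nat) : (p%:P ^+ (n - i) * (q%:P * 'X) ^+ i *+ 'C(n, i))`_k =
    if i == k then p ^+ (n - k) * q ^+ k *+ 'C(n, k) else 0.
  rewrite coefMn exprMn -!rmorphXn /= mulrA -rmorphM /= coefCM coefXn eq_sym.
  by case: eqP => [->|_]; rewrite ?mulr1 // mulr0 mul0rn.
under eq_bigr => i _ do rewrite E.
rewrite -big_mkcond /= (big_ord1_eq _ (fun=> _)).
by case: ltnP => // lt_nk; rewrite bin_small.
Qed.

Lemma coef_linform_exp (C : numClosedFieldType) (a b c : C) i j k :
  (((linform a b c ^+ (i + j + k))`_k)`_j)`_i =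
  a ^+ i * b ^+ j * c ^+ k *+ ('C(i + j + k, k) * 'C(i + j, j)).
Proof.
have -> : linform a b c = ((a%:P * 'X)%:P + (b%:P)%:P * 'X)%:P + (c%:P%:P)%:P * 'X.
  by rewrite /linform /cst3 /varx /vary /varz !rmorphD !rmorphM.
rewrite coef_linear_exp addnK coefMn coefMn.
rewrite -[c%:P%:P ^+ k]rmorphXn -[c%:P ^+ k]rmorphXn /= coefMC coefMC.
rewrite coef_linear_exp addnK coefMn -[b%:P ^+ j]rmorphXn /= coefMC.
rewrite exprMn -rmorphXn /= coefCM coefXn eqxx mulr1.
by rewrite mulrnAl -mulrnA mulnC.
Qed.

Lemma coef_monomial (C : numClosedFieldType) a b c i j k :
  (((varx C ^+ a * vary C ^+ b * varz C ^+ c)`_k)`_j)`_i =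
    ((i, j, k) == (a, b, c))%:R.
Proof.
rewrite /varx /vary /varz -!rmorphXn -rmorphM /= coefCM coefXn !xpair_eqE.
case: (k == c); last by rewrite andbF mulr0 !coef0.
rewrite andbT mulr1 coefCM coefXn.
case: (j == b); last by rewrite andbF mulr0 coef0.
by rewrite andbT mulr1 coefXn.
Qed.

Lemma coef_F12 (C : numClosedFieldType) i j k :
  (((F12 C)`_k)`_j)`_i =
    ((i, j, k) == (1, 1, 3)%N)%:R + ((i, j, k) == (0, 4, 1)%N)%:R.
Proof.
rewrite -!coef_monomial -!coefD /F12.
by rewrite !expr1 expr0 mul1r.
Qed.

(** Comparing coefficients divides those of [F] by multinomial coefficients: 20 for [x y z^3] and 5
    for [y^4 z]. *)
Lemma power_sums_F12 (C : numClosedFieldType) r (a b c w : 'I_r -> C) :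
  F12 C = \sum_(l < r) cst3 (w l) * linform (a l) (b l) (c l) ^+ 5 ->
  forall i j k, (i + j + k = 5)%N ->
  \sum_l w l * (a l ^+ i * b l ^+ j * c l ^+ k) =
    if (i, j, k) == (1, 1, 3)%N then 20^-1 else
    if (i, j, k) == (0, 4, 1)%N then 5^-1 else 0.
Proof.
move=> eqF i j k deg5.
have /(congr1 (fun p : poly3 C => ((p`_k)`_j)`_i)) := eqF.
rewrite coef_F12 !coef_sum.
under eq_bigr => l _.
  rewrite /cst3 !coefCM -deg5 coef_linform_exp mulrnAr.
  over.
rewrite sumrMnl deg5.
set T := \sum_(l < r) _; set n := (_ * _)%N => eqT.
have n_neq0 : n%:R != 0 :> C.
  by rewrite pnatr_eq0 -lt0n muln_gt0 !bin_gt0; lia.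
apply: (mulIf n_neq0); rewrite [LHS]mulr_natr -eqT {eqT T n_neq0} /n {n}.
case: eqP => [[-> -> ->]|_] /=.
  by rewrite addr0 mulVf ?pnatr_eq0.
case: eqP => [[-> -> ->]|_] /=; last by rewrite addr0 mul0r.
by rewrite add0r mulVf ?pnatr_eq0.
Qed.

Lemma F12_decomp_lower (C : numClosedFieldType) r :
  waring_decomp (F12 C) 5 r -> (10 <= r)%N.
Proof.
move=> [a [b [c [k eqF]]]].
have psum := power_sums_F12 eqF.
pose S := [set i | a i != 0].
(* Normalising a form moves [a^5] into its weight. This weight vanishes off [S], so the default
   value of division by zero never counts. *)
pose w i := k i * a i ^+ 5.
pose mom s t := \sum_i w i * ((b i / a i) ^+ s * (c i / a i) ^+ t).
pose inf s t := \sum_(i in ~: S) k i * (b i ^+ s * c i ^+ t).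
have wS i : i \notin S -> w i = 0.
  by rewrite inE negbK /w => /eqP ->; rewrite expr0n mulr0.
have wE i s t : i \in S -> (s + t <= 5)%N ->
    w i * ((b i / a i) ^+ s * (c i / a i) ^+ t) =
    k i * (a i ^+ (5 - (s + t)) * b i ^+ s * c i ^+ t).
  rewrite inE => ai0 le5.
  rewrite /w !expr_div_n -{1}(subnK le5) !exprD.
  by field; rewrite !expf_neq0.
(* Up to degree 4 a factor [a i] remains: it kills the forms with [a = 0] and rules out the term
   [y^4 z]. *)
have momlow s t : (s + t <= 4)%N -> mom s t = if (s, t) == (1, 3)%N then 20^-1 else 0.
  move=> le4; have le5 : (s + t <= 5)%N by lia.
  transitivity (\sum_i k i * (a i ^+ (5 - (s + t)) * b i ^+ s * c i ^+ t)).
    apply: eq_bigr => i _; have [iS|iS] := boolP (i \in S); first exact: wE.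
    rewrite (wS _ iS) mul0r; move: iS; rewrite inE negbK => /eqP ->.
    by rewrite expr0n subn_eq0 leqNgt ltnS le4 !mul0r mulr0.
  rewrite psum; last lia.
  have -> : ((5 - (s + t), s, t) == (1, 1, 3))%N = ((s, t) == (1, 3)%N).
    by rewrite !xpair_eqE; lia.
  by rewrite [_ == (0, 4, 1)%N]negbTE // !xpair_eqE; lia.
(* In degree 5 no factor [a i] is left, so the contribution of the forms with [a = 0] has to be
   subtracted. *)
have momtop s t : (s + t = 5)%N ->
    mom s t = (if (s, t) == (4, 1)%N then 5^-1 else 0) - inf s t.
  move=> st5; have := psum 0%N s t st5; rewrite !xpair_eqE /= => <-.
  rewrite (bigID (mem S)) /= /mom (bigID (mem S)) /=.
  rewrite [X in _ + X = _]big1 ?addr0; last by move=> i /wS ->; rewrite mul0r.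
  rewrite [X in _ = _ + X - _](_ : _ = inf s t); last first.
    by apply: eq_big => [i|i _]; rewrite ?in_setC // expr0 mul1r.
  by rewrite addrK; apply: eq_bigr => i iS; rewrite wE ?st5.
have low s t : (s + t <= 4)%N -> (mom s t == 0) = ((s, t) != (1, 3)%N).
  by move=> /momlow ->; case: ifP; rewrite ?invr_eq0 ?pnatr_eq0 ?eqxx.
(* Each list below holds the eight factorisations of [u v^3] by weakly decreasing column degree;
   pairs factoring a degree 5 monomial with nonzero moment are inserted among them. *)
have bound := moment_points_card wS low.
have := cardsC S; rewrite card_ord => <-.
have [inf0|inf1|inf2] := ltngtP #|~: S| 1.
- have S0 : ~: S = set0 by apply/eqP; rewrite -cards_eq0; lia.
  have nz : mom 4%N 1%N != 0.
    by rewrite momtop // /inf S0 big_set0 subr0 invr_eq0 pnatr_eq0.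
  have := bound (4, 1)%N [:: ((1, 3), (0, 0)); ((0, 3), (1, 0)); ((1, 2), (0, 1));
    ((2, 1), (2, 0)); ((0, 2), (1, 1)); ((1, 1), (0, 2)); ((2, 0), (2, 1));
    ((1, 0), (0, 3)); ((0, 1), (1, 2)); ((0, 0), (1, 3))]%N nz isT isT.
  by move=> leS; apply: leq_trans leS (leq_addr _ _).
- have nz : mom 1%N 3%N != 0 by rewrite low.
  have := bound (1, 3)%N [:: ((1, 3), (0, 0)); ((0, 3), (1, 0)); ((1, 2), (0, 1));
    ((0, 2), (1, 1)); ((1, 1), (0, 2)); ((1, 0), (0, 3)); ((0, 1), (1, 2));
    ((0, 0), (1, 3))]%N nz isT isT.
  by move=> leS; apply: leq_add leS inf1.
have [l Sl] : exists l, ~: S = [set l] by apply/cards1P/eqP.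
have infE s t : inf s t = k l * (b l ^+ s * c l ^+ t) by rewrite /inf Sl big_set1.
have [nz|] := boolP (mom 4%N 1%N != 0).
  have := bound (4, 1)%N [:: ((1, 3), (0, 0)); ((0, 3), (1, 0)); ((1, 2), (0, 1));
    ((2, 1), (2, 0)); ((0, 2), (1, 1)); ((1, 1), (0, 2));
    ((1, 0), (0, 3)); ((0, 1), (1, 2)); ((0, 0), (1, 3))]%N nz isT isT.
  by rewrite inf2 addn1.
(* If the moment of [u^4 v] vanishes, the single form with [a = 0] carries all of [y^4 z], so its
   [b] is nonzero. As [F] has no term [y^5], the moment of [u^5] is then nonzero. *)
rewrite negbK momtop // infE subr_eq0 /= => /eqP klbl.
have : 5^-1 != 0 :> C by rewrite invr_eq0 pnatr_eq0.
rewrite klbl mulf_eq0 mulf_eq0 expf_eq0 !negb_or /= => /and3P[kl0 bl0 _].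
have nz : mom 5%N 0%N != 0.
  by rewrite momtop // infE sub0r oppr_eq0 expr0 mulr1 mulf_neq0 ?expf_neq0.
have := bound (5, 0)%N [:: ((1, 3), (0, 0)); ((0, 3), (1, 0)); ((1, 2), (0, 1));
  ((3, 0), (2, 0)); ((0, 2), (1, 1)); ((1, 1), (0, 2));
  ((1, 0), (0, 3)); ((0, 1), (1, 2)); ((0, 0), (1, 3))]%N nz isT isT.
by rewrite inf2 addn1.
Qed.

(** Only even powers of [i] survive, so a conjugate pair of forms contributes a polynomial free of
    [i]. *)
Lemma imaginary_quintic_difference (R : comNzRingType) (i p q : R) : i ^+ 2 = -1 ->
  i * (p + i * q) ^+ 5 - i * (p - i * q) ^+ 5 =
  - (10 * p ^+ 4 * q - 20 * p ^+ 2 * q ^+ 3 + 2 * q ^+ 5).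
Proof.
move=> i2.
transitivity (10 * p ^+ 4 * q * i ^+ 2 + 20 * p ^+ 2 * q ^+ 3 * (i ^+ 2) ^+ 2
   + 2 * q ^+ 5 * (i ^+ 2) ^+ 3); first by ring.
by rewrite i2; ring.
Qed.

(* [(y + z)^5 - (y - z)^5] reduces [F] to [z^3 (x' y - z^2 / 5)], where
   [x' = x - 2 y].  In dual variables [(s, t, u)] of [(x', y, z)], the latter is
   annihilated by [s^2 - t^2] and [u^4 + 4 s t u^2 + A s^4] for every [A]; the
   value [A = -225/16] makes their eight common zeros rational over [Q(i)]. *)
Lemma F12_decomp (C : numClosedFieldType) : waring_decomp (F12 C) 5 10.
Proof.
pose i : C := 'i; have i2 : i ^+ 2 = -1 by rewrite sqrCi.
pose h : C := (320 * 510)^-1.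
(* The last eight forms are the zeros with [s = 2], [t = 2] or [-2]; substituting [x' = x - 2 y]
   turns the coefficient [t] of [y] into [t - 4]. *)
exists (fun l => [:: 0; 0; 2; 2; 2; 2; 2; 2; 2; 2]`_l).
exists (fun l => [:: 1; 1; -2; -2; -2; -2; -6; -6; -6; -6]`_l).
exists (fun l => [:: 1; -1; i * 5; - (i * 5); 3; -3; 5; -5; i * 3; - (i * 3)]`_l).
(* The first two weights are [1/10] and [-1/10]. The others are [t / (320 q'(u))], with [q] the
   quartic in [u] at the given [s], [t]: by Lagrange interpolation the sums of [u^m / q'(u)] over
   its roots are 0 for [m < 3] and 1 for [m = 3]. *)
exists (fun l => h * [:: 32 * 510; - (32 * 510); 3 * i; - (3 * i); 5; -5; -3; 3; - (5 * i); 5 * i]`_l).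
rewrite !big_ord_recl big_ord0 /=.
have cst3M (s t : C) : cst3 (s * t) = cst3 s * cst3 t by rewrite /cst3 !rmorphM.
have cst3N (s : C) : cst3 (- s) = - cst3 s by rewrite /cst3 !rmorphN.
have cst3n n : cst3 (n%:R : C) = n%:R by rewrite /cst3 !rmorph_nat.
have I2 : cst3 i ^+ 2 = -1 by rewrite expr2 -cst3M -expr2 i2 cst3N (cst3n 1%N).
have H1 : cst3 h * (320 * 510) = 1.
  rewrite -(cst3n 320%N) -(cst3n 510%N) -!cst3M mulVf ?(cst3n 1%N) //.
  by rewrite mulf_neq0 ?pnatr_eq0.
rewrite /linform !cst3M !cst3N !cst3M !(cst3n 0%N) !(cst3n 1%N) !cst3n.
rewrite /F12; move: (cst3 h) (cst3 i) (varx C) (vary C) (varz C) H1 I2 => H I x y z H1 I2.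
transitivity (H * (320 * 510) * (x * y * z ^+ 3 + y ^+ 4 * z)); first by rewrite H1 mul1r.
have e1 := imaginary_quintic_difference (2 * x - 2 * y) (5 * z) I2.
have e2 := imaginary_quintic_difference (2 * x - 6 * y) (3 * z) I2.
transitivity (H * (32 * 510 * ((y + z) ^+ 5 - (y - z) ^+ 5)
  + 3 * (I * (2 * x - 2 * y + I * (5 * z)) ^+ 5 - I * (2 * x - 2 * y - I * (5 * z)) ^+ 5)
  + 5 * ((2 * x - 2 * y + 3 * z) ^+ 5 - (2 * x - 2 * y - 3 * z) ^+ 5)
  - 3 * ((2 * x - 6 * y + 5 * z) ^+ 5 - (2 * x - 6 * y - 5 * z) ^+ 5)
  - 5 * (I * (2 * x - 6 * y + I * (3 * z)) ^+ 5 - I * (2 * x - 6 * y - I * (3 * z)) ^+ 5))).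
  by rewrite e1 e2; ring.
ring.
Qed.

Theorem mainTheorem12 (C : numClosedFieldType) : waring_rank_is (F12 C) 5 10.
Proof. by split; [exact: F12_decomp | move=> r; exact: F12_decomp_lower]. Qed.
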